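(* In the Heisenberg group $\mathbb{H}^n$, with coordinates $(x_1,\dots,x_{2n},z)$, the Kaplan norm $N_{Kaplan}$ satisfies $$N_{Kaplan}^4=\frac12\left(W_+^2+W_-^2+2V^2\right),$$ where $$W_\pm\equiv4z\pm2\sum_{j=1}^nx_jx_{2n-j+1},\qquad V^2\equiv\sum_{j=1}^n\sum_{k=1}^nV_{j,k}^2,\qquad V_{j,k}\equiv(x_j-x_{2n-j+1})(x_k+x_{2n-k+1}).$$
   Context: The Kaplan norm is $N_{Kaplan}=\left(\left(\sum_{i=1}^{2n}x_i^2\right)^2+16z^2\right)^{1/4}$. *)

(* Defs.v *)
From HB Require Import structures.
From mathcomp Require Import all_boot all_order all_algebra.
From mathcomp Require Import reals exp.
From mathcomp Require Import ring.

Set Implicit Arguments.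
Unset Strict Implicit.
Unset Printing Implicit Defensive.

Import Order.TTheory GRing.Theory Num.Theory.
Local Open Scope ring_scope.

Record heisenberg (R : realType) (n : nat) : Type := Heisenberg {
  horizontal : 'rV[R]_(2 * n);
  vertical : R
}.

Fact leq_double_dim (n : nat) : (n <= 2 * n)%N.
Proof. exact: leq_pmull. Qed.

(* Indices start from 0: if j : 'I_n stands for the 1-based index j + 1, then
   idx j stands for j + 1 and idx' j for 2n - (j + 1) + 1. *)
Definition idx (n : nat) (j : 'I_n) : 'I_(2 * n) :=
  widen_ord (leq_double_dim n) j.
Definition idx' (n : nat) (j : 'I_n) : 'I_(2 * n) := rev_ord (idx j).

Section GroupLaw.
Variables (R : realType) (n : nat).
Implicit Types (x y : 'rV[R]_(2 * n)) (p q : heisenberg R n).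

Definition symplectic_form x y : R :=
  \sum_(j < n) (x 0 (idx j) * y 0 (idx' j) - x 0 (idx' j) * y 0 (idx j)).

(* The factor 1/2 is the normalization for which the coefficient of z^2 in the
   Kaplan norm is 16. *)
Definition heis_mul p q : heisenberg R n :=
  Heisenberg (horizontal p + horizontal q)
    (vertical p + vertical q
       + 2^-1 * symplectic_form (horizontal p) (horizontal q)).
Definition heis_one : heisenberg R n := Heisenberg 0 0.
Definition heis_inv p : heisenberg R n :=
  Heisenberg (- horizontal p) (- vertical p).

Fact symplectic_formDl x1 x2 y :
  symplectic_form (x1 + x2) y = symplectic_form x1 y + symplectic_form x2 y.
Proof.
by rewrite -big_split; apply: eq_bigr => j _; rewrite !mxE /=; ring.
Qed.

Fact symplectic_formNr x y : symplectic_form y x = - symplectic_form x y.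
Proof. by rewrite -sumrN; apply: eq_bigr => j _; ring. Qed.

Fact symplectic_formDr x y1 y2 :
  symplectic_form x (y1 + y2) = symplectic_form x y1 + symplectic_form x y2.
Proof.
by rewrite !(symplectic_formNr _ x) symplectic_formDl opprD.
Qed.

Fact symplectic_form0l x : symplectic_form 0 x = 0.
Proof. by rewrite /symplectic_form big1 // => j _; rewrite !mxE; ring. Qed.

Fact symplectic_formNx x : symplectic_form (- x) x = 0.
Proof. by rewrite /symplectic_form big1 // => j _; rewrite !mxE; ring. Qed.

Fact heis_mulA : associative heis_mul.
Proof.
move=> p q r; congr Heisenberg; rewrite /= ?addrA //.
by rewrite symplectic_formDl symplectic_formDr; ring.
Qed.

Fact heis_mul1g : left_id heis_one heis_mul.
Proof.
case=> x z; congr Heisenberg; rewrite /= ?add0r //.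
by rewrite symplectic_form0l mulr0 addr0.
Qed.

Fact heis_mulg1 : right_id heis_one heis_mul.
Proof.
case=> x z; congr Heisenberg; rewrite /= ?addr0 //.
by rewrite symplectic_formNr symplectic_form0l oppr0 mulr0 addr0.
Qed.

Fact heis_mulVg : left_inverse heis_one heis_inv heis_mul.
Proof.
case=> x z; congr Heisenberg; rewrite /= addNr //.
by rewrite symplectic_formNx mulr0 addr0.
Qed.

Fact heis_mulgV : right_inverse heis_one heis_inv heis_mul.
Proof.
case=> x z; congr Heisenberg; rewrite /= subrr //.
by rewrite symplectic_formNr symplectic_formNx oppr0 mulr0 addr0.
Qed.

Fact heis_pairK :
  cancel (fun p => (horizontal p, vertical p))
         (fun u => Heisenberg u.1 u.2).
Proof. by case. Qed.

HB.instance Definition _ := Choice.copy (heisenberg R n) (can_type heis_pairK).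
HB.instance Definition _ := isGroup.Build (heisenberg R n)
  heis_mulA heis_mul1g heis_mulg1 heis_mulVg heis_mulgV.

End GroupLaw.

Section Kaplan.
Variables (R : realType) (n : nat).
Implicit Types p : heisenberg R n.

Definition N_Kaplan p : R :=
  ((\sum_(i < 2 * n) horizontal p 0 i ^+ 2) ^+ 2 + 16 * vertical p ^+ 2)
    `^ 4^-1.

Definition W_plus p : R :=
  4 * vertical p
    + 2 * \sum_(j < n) horizontal p 0 (idx j) * horizontal p 0 (idx' j).

Definition W_minus p : R :=
  4 * vertical p
    - 2 * \sum_(j < n) horizontal p 0 (idx j) * horizontal p 0 (idx' j).

Definition V_entry p (j k : 'I_n) : R :=
  (horizontal p 0 (idx j) - horizontal p 0 (idx' j))
    * (horizontal p 0 (idx k) + horizontal p 0 (idx' k)).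

(* The quantity written V^2; V itself is never used. *)
Definition V_squared p : R := \sum_(j < n) \sum_(k < n) V_entry p j k ^+ 2.

End Kaplan.

(* Main.v *)
Require Import Defs.
From mathcomp Require Import all_boot all_order all_algebra.
From mathcomp Require Import reals.
From mathcomp Require Import exp ring.
Import Order.TTheory GRing.Theory Num.Theory.

Local Open Scope ring_scope.

(** Write a_j and b_j for the coordinates x_j and x_(2n-j+1), and put
    Q = |x|^2 = \sum_j (a_j^2 + b_j^2) and S = \sum_j a_j b_j.
    The double sum V^2 factors as
    (\sum_j (a_j - b_j)^2) (\sum_k (a_k + b_k)^2) = (Q - 2 S) (Q + 2 S)
    = Q^2 - 4 S^2 ([V_squaredE]), while W_+^2 + W_-^2 = 32 z^2 + 8 S^2 by the
    parallelogram identity. The terms in S cancel in the right-hand side, which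
    is thus Q^2 + 16 z^2, the fourth power of the norm ([N_Kaplan_exp4]). *)

(** The indices 0, ..., 2n-1 are paired off by idx j <-> idx' j. *)
Lemma sum_idx (V : nmodType) (n : nat) (F : 'I_(2 * n) -> V) :
  \sum_(i < 2 * n) F i = \sum_(j < n) (F (idx j) + F (idx' j)).
Proof.
have e : (n + n = 2 * n)%N by rewrite mul2n addnn.
rewrite (reindex (cast_ord e)); last first.
  by apply: onW_bij; exists (cast_ord (esym e)); [apply: cast_ordK | apply: cast_ordKV].
rewrite big_split_ord big_split /=; congr (_ + _).
  by apply: eq_bigr => j _; congr F; apply: val_inj.
rewrite (reindex_inj rev_ord_inj); apply: eq_bigr => j _.
congr F; apply: val_inj => /=.
by rewrite addnBA // mul2n addnn.
Qed.

Lemma N_Kaplan_exp4 (R : realType) (n : nat) (p : heisenberg R n) :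
  N_Kaplan p ^+ 4 =
    (\sum_(i < 2 * n) horizontal p 0 i ^+ 2) ^+ 2 + 16 * vertical p ^+ 2.
Proof.
rewrite /N_Kaplan -powR_mulrn ?powR_ge0 // -powRrM mulVf ?pnatr_eq0 //.
by rewrite powRr1 // addr_ge0 ?sqr_ge0 // mulr_ge0 ?sqr_ge0.
Qed.

Lemma V_squaredE (R : realType) (n : nat) (p : heisenberg R n) :
  V_squared p =
    (\sum_(i < 2 * n) horizontal p 0 i ^+ 2) ^+ 2
    - 4 * (\sum_(j < n) horizontal p 0 (idx j) * horizontal p 0 (idx' j)) ^+ 2.
Proof.
rewrite sum_idx.
set a := fun j : 'I_n => horizontal p 0 (idx j).
set b := fun j : 'I_n => horizontal p 0 (idx' j).
rewrite -[X in X ^+ 2 - _]/(\sum_(j < n) (a j ^+ 2 + b j ^+ 2)).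
rewrite -[X in _ - _ * X ^+ 2]/(\sum_(j < n) a j * b j).
have -> : V_squared p =
    (\sum_(j < n) (a j - b j) ^+ 2) * (\sum_(k < n) (a k + b k) ^+ 2).
  rewrite /V_squared big_distrlr /=.
  by apply: eq_bigr => j _; apply: eq_bigr => k _; rewrite -exprMn.
have -> : \sum_(j < n) (a j - b j) ^+ 2 =
    \sum_(j < n) (a j ^+ 2 + b j ^+ 2) - 2 * \sum_(j < n) a j * b j.
  by rewrite mulr_sumr -sumrB; apply: eq_bigr => j _; ring.
have -> : \sum_(k < n) (a k + b k) ^+ 2 =
    \sum_(j < n) (a j ^+ 2 + b j ^+ 2) + 2 * \sum_(j < n) a j * b j.
  by rewrite mulr_sumr -big_split; apply: eq_bigr => j _ /=; ring.
by ring.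
Qed.

Theorem theorem23 (R : realType) (n : nat) (hn : (0 < n)%N)
    (p : heisenberg R n) :
  N_Kaplan p ^+ 4 =
    2^-1 * (W_plus p ^+ 2 + W_minus p ^+ 2 + 2 * V_squared p).
Proof.
by rewrite N_Kaplan_exp4 V_squaredE /W_plus /W_minus; field.
Qed.
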